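(* Let $(X,d)$ be a discrete metric space of bounded geometry which coarsely has unbounded components. Then $X$ has property A if and only if $X$ has naive property A.
   Context: Let $(X,d)$ be a discrete metric space. For $x\in X$ and $R>0$ write $B(x,R):=\{y\in X: d(y,x)\le R\}$. $X$ has *bounded geometry* if $\sup_{x\in X}|B(x,R)|<\infty$ for every $R>0$. $X$ has *property A* if for any $R,\varepsilon>0$ there exists a family $\{A_x\}_{x\in X}$ of finite, non-empty subsets of $X\times\mathbb{N}$ such that: (1) for any $x,y\in X$ with $d(x,y)\le R$, $\frac{|A_x\triangle A_y|}{|A_x\cap A_y|}<\varepsilon$; (2) there exists $S>0$ such that for any $x\in X$ and any $(y,n)\in A_x$, $d(x,y)\le S$. $X$ has *naive property A* if for any $R,\varepsilon>0$ there exists a family $\{A_x\}_{x\in X}$ of finite, non-empty subsets of $X$ such that: (1) for any $x,y\in X$ with $d(x,y)\le R$, $\frac{|A_x\triangle A_y|}{|A_x\cap A_y|}<\varepsilon$; (2) there exists $S>0$ such that for any $x\in X$ and any $y\in A_x$, $d(x,y)\le S$. In both definitions, the inequality in (1) is understood to include that $A_x\cap A_y\neq\emptyset$. The *$r$-Rips complex* of $X$ is the simplicial complex with vertex set $X$ whose simplices are the finite subsets $\{x_0,\dots,x_n\}\subseteq X$ with $d(x_i,x_j)\le r$ for all $i,j$. $X$ *coarsely has unbounded components* if for some $r$ every connected component of the $r$-Rips complex is unbounded (that is, its set of vertices is an unbounded subset of $X$). *)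

(* Defs.v *)
From HB Require Import structures.
From mathcomp Require Import all_boot all_order all_algebra.
From mathcomp Require Import finmap.
From mathcomp Require Import all_classical all_reals.
From mathcomp Require Import interval_inference topology.

Set Implicit Arguments.
Unset Strict Implicit.
Unset Printing Implicit Defensive.

Import Order.TTheory GRing.Theory Num.Theory.

Local Open Scope card_scope.
Local Open Scope classical_set_scope.
Local Open Scope ring_scope.

(* The condition [nbhs_principalE] of [discreteNbhsType], stated for the
   topology that the metric induces (the distance need not be 0-1 valued). *)
Definition discrete_space (X : nbhsType) : Prop :=
  @nbhs X X = principal_filter.

(* Not the library's [closed_ball], which is the closure of the open ball. *)
Definition cball (R : realType) (X : metricType R) (x : X) (r : R) : set X :=
  [set y | mdist y x <= r].

(* [A #<= `I_N] says that A is finite with at most N elements, so N is an upper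
   bound for all the cardinals, that is, their supremum is finite. *)
Definition bounded_geometry (R : realType) (X : metricType R) : Prop :=
  forall r : R, 0 < r -> exists N : nat, forall x : X, cball x r #<= `I_N.

Definition symdiff (T : choiceType) (A B : {fset T}) : {fset T} :=
  ((A `\` B) `|` (B `\` A))%fset.

(* Nonemptiness of the intersection is explicit because x / 0 = 0. *)
Definition almost_equal (R : realType) (T : choiceType) (eps : R)
    (A B : {fset T}) : Prop :=
  (A `&` B)%fset != fset0 /\
  #|` symdiff A B|%:R / #|` (A `&` B)%fset|%:R < eps.

Definition property_A (R : realType) (X : metricType R) : Prop :=
  forall r eps : R, 0 < r -> 0 < eps ->
  exists A : X -> {fset (X * nat)%type},
    [/\ forall x, A x != fset0,
        forall x y, mdist x y <= r -> almost_equal eps (A x) (A y)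
      & exists2 S : R, 0 < S &
          forall (x y : X) (n : nat), (y, n) \in A x -> mdist x y <= S].

Definition naive_property_A (R : realType) (X : metricType R) : Prop :=
  forall r eps : R, 0 < r -> 0 < eps ->
  exists A : X -> {fset X},
    [/\ forall x, A x != fset0,
        forall x y, mdist x y <= r -> almost_equal eps (A x) (A y)
      & exists2 S : R, 0 < S &
          forall x y, y \in A x -> mdist x y <= S].

Record simplicial_complex (V : choiceType) := SimplicialComplex {
  simplex : set {fset V};
  simplex_neq0 : forall s, simplex s -> s != fset0;
  simplex_vertex : forall v, simplex [fset v]%fset;
  simplex_face : forall s t : {fset V},
    simplex s -> t != fset0 -> (t `<=` s)%fset -> simplex t
}.

(* The set of vertices of the connected component containing v: the vertices
   that an edge path joins to v. *)
Definition component (V : choiceType) (K : simplicial_complex V) (v : V) :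
    set V :=
  [set w | exists2 p : seq V,
     path (fun a b => `[< simplex K [fset a; b]%fset >]) v p & last v p = w].

Section Rips.
Context (R : realType) (X : metricType R).

Definition rips_simplex (r : R) : set {fset X} :=
  [set s | s != fset0 /\ forall x y, x \in s -> y \in s -> mdist x y <= r].

Lemma rips_simplex_neq0 r s : rips_simplex r s -> s != fset0.
Proof. by case. Qed.

Lemma rips_simplex_vertex (r : {nonneg R}) x :
  rips_simplex r%:num [fset x]%fset.
Proof.
split=> [|y z]; first by apply/fset0Pn; exists x; rewrite inE.
by rewrite !inE => /eqP-> /eqP->; rewrite mdistxx.
Qed.

Lemma rips_simplex_face r s t : rips_simplex r s ->
  t != fset0 -> (t `<=` s)%fset -> rips_simplex r t.
Proof.
by case=> _ sr t0 /fsubsetP ts; split=> // x y /ts xs /ts; exact: sr.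
Qed.

(* r >= 0, since otherwise points would not be vertices. *)
Definition rips_complex (r : {nonneg R}) : simplicial_complex X :=
  SimplicialComplex (@rips_simplex_neq0 r%:num) (rips_simplex_vertex r)
    (@rips_simplex_face r%:num).

End Rips.

(* The library's [bounded_set] is about normed spaces. *)
Definition unbounded (R : realType) (X : metricType R) (A : set X) : Prop :=
  ~ exists M : R, forall x y, A x -> A y -> mdist x y <= M.

Definition coarsely_unbounded_components (R : realType) (X : metricType R) :
    Prop :=
  exists r : {nonneg R},
    forall x : X, unbounded (component (rips_complex X r) x).

(* Main.v *)
Require Import Defs.
From mathcomp Require Import all_boot all_order all_algebra.
From mathcomp Require Import finmap zify lra.
From mathcomp Require Import all_classical all_reals topology.
From mathcomp Require Import interval_inference.

Set Implicit Arguments.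
Unset Strict Implicit.
Unset Printing Implicit Defensive.

Import Order.TTheory GRing.Theory Num.Theory.

(** Naive property A is the special case of property A in which all labels are
    equal, so the content is the other implication: the labels in [X * nat]
    have to be replaced by points of [X].  It is not possible in general to
    inject [X * 'I_M] into [X] by a map at bounded distance from the first
    projection (on the integers this would contradict amenability), so mass is
    concentrated first, in two steps.

    Bounded cardinality ([property_A_bounded]).  Let [g_x y] be the number of
    labels above [y] in [A_x], so that [g_x / |A_x|] is a probability measure.
    Rounding its values down to multiples of [1 / M] gives the finite set
    [normalize M A_x], with at most [M] elements.  The rounding loses at most
    one element above each of the at most [K] points of the support, where [K]
    bounds the cardinals of balls by bounded geometry; hence the loss is
    negligible once [M] is large with respect to [K].

    Concentration ([disjoint_cells], [compress]).  An unbounded component of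
    the Rips complex contains, from each of its points, simple paths of any
    given length; so every ball of radius [r * M] has at least [M] points.
    Choosing a maximal [2 r M]-separated set [Y], the balls of radius [r * M]
    about points of [Y] are disjoint cells with at least [M] points each, and
    every point of [X] is at distance at most [2 r M] from some point [p x] of
    [Y].  Now move all the elements of [A] above a point [x] to [p x], and
    replace the [k] elements that land on [y] by the first [k] points of the
    cell of [y].  For sets with at most [M] elements there is room, the
    cardinality is preserved, and the operation is monotone.

    These two properties are all that is needed, because the condition on
    [A_x] and [A_y] amounts to a lower bound on the cardinality of the
    intersection in terms of those of both sets ([almost_equalE]): a monotone
    operation that preserves cardinals can only enlarge the intersection
    ([almost_equal_monotone_isocard]). *)

Local Open Scope fset_scope.
Local Open Scope nat_scope.

(** * Almost equality in terms of cardinals *)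

(** Adding twice the cardinality of the intersection to that of the symmetric
    difference gives the sum of both cardinals.  The strict inequality cannot
    hold when the intersection is empty, since its right-hand side is then
    zero. *)
Lemma almost_equalE (R : realType) (T : choiceType) (eps : R)
    (A B : {fset T}) :
  almost_equal eps A B <->
  ((#|` A| + #|` B|)%:R < (2 + eps) * #|` A `&` B|%:R)%R.
Proof.
have cardD : #|` A| + #|` B| = #|` symdiff A B| + 2 * #|` A `&` B|.
  have disj : (A `\` B) `&` (B `\` A) = fset0.
    by apply/fsetP => x; rewrite !inE; case: (x \in A); case: (x \in B).
  rewrite -(cardfsID B A) -(cardfsID A B) (fsetIC B A) /symdiff.
  by rewrite cardfsU disj cardfs0 subn0; lia.
rewrite /almost_equal -cardfs_gt0 cardD natrD natrM addrC.
rewrite [((2 + eps) * _)%R]mulrDl ltrD2l.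
split=> [[I_gt0]|]; first by rewrite ltr_pdivrMr // ltr0n.
case: posnP => [->|I_gt0 lt]; first by rewrite mulr0 ltrn0.
by split=> //; rewrite ltr_pdivrMr // ltr0n.
Qed.

(** Monotonicity sends the intersection of [A] and [B] into that of their
    images, while preservation of cardinals keeps its size. *)
Lemma almost_equal_monotone_isocard (R : realType) (T U : choiceType) (eps : R)
    (F : {fset T} -> {fset U}) (A B : {fset T}) :
    (forall C D, C `<=` D -> F C `<=` F D) ->
    (forall C, C `<=` A \/ C `<=` B -> #|` F C| = #|` C|) -> (0 < eps)%R ->
  almost_equal eps A B -> almost_equal eps (F A) (F B).
Proof.
move=> F_mono F_card eps_gt0 /almost_equalE AB; apply/almost_equalE.
rewrite !F_card; [|by right|by left].
apply: (lt_le_trans AB); apply: ler_wpM2l; first lra.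
rewrite ler_nat.
rewrite -F_card; last by left; exact: fsubsetIl.
by apply/fsubset_leq_card/fsubsetIP; split; apply: F_mono;
  [exact: fsubsetIl|exact: fsubsetIr].
Qed.

(** * Sets of labelled points with prescribed fibers *)

Section Stack.
Variable T : choiceType.
Implicit Types (Y Z : {fset T}) (f g : T -> nat).

(** The region under the graph of [f] over [Y]: it represents the
    integer-valued function [f] on [Y] as a finite set, in such a way that
    intersections compute minima. *)
Definition stack Y f : {fset T * nat} :=
  [fset u in [seq (y, i) | y <- Y, i <- iota 0 (f y)]].

Lemma in_stack Y f y i : ((y, i) \in stack Y f) = (y \in Y) && (i < f y).
Proof.
rewrite !inE /=; apply/allpairsPdep/andP => [[z [j [zY]]]|[yY iy]].
  by rewrite mem_iota add0n => /= jz [-> ->].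
by exists y, i; rewrite mem_iota.
Qed.

Lemma card_stack Y f : #|` stack Y f| = \sum_(y <- Y) f y.
Proof.
rewrite card_fseq undup_id; last first.
  apply: allpairs_uniq_dep => [|y _|[y i] [z j] _ _ /= [-> ->]] //.
  exact: iota_uniq.
rewrite size_allpairs_dep sumnE big_map.
by apply: eq_bigr => y _; rewrite size_iota.
Qed.

Lemma stackS Y Z f g :
  Y `<=` Z -> (forall y, y \in Y -> f y <= g y) -> stack Y f `<=` stack Z g.
Proof.
move=> /fsubsetP YZ fg; apply/fsubsetP => -[y i]; rewrite !in_stack.
by move=> /andP[yY iy]; rewrite YZ // (leq_trans iy) // fg.
Qed.

End Stack.

Section Fibers.
Variables (T U : choiceType) (p : T -> U).
Implicit Types A B : {fset T}.

Definition fiber_card A u := #|` [fset a in A | p a == u]|.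

Lemma fiber_cardS A B u : A `<=` B -> fiber_card A u <= fiber_card B u.
Proof.
move=> /fsubsetP AB; apply/fsubset_leq_card/fsubsetP => a.
by rewrite !inE => /andP[/AB -> ->].
Qed.

Lemma fiber_card_le A u : fiber_card A u <= #|` A|.
Proof. by apply/fsubset_leq_card/fsubsetP => a; rewrite !inE => /andP[]. Qed.

Lemma sum_fiber_card A : \sum_(u <- p @` A) fiber_card A u = #|` A|.
Proof.
rewrite card_fset_sum1 (partition_big_imfset _ p) /=.
apply: eq_bigr => u _; rewrite /fiber_card card_fset_sum1.
by rewrite big_fset.
Qed.

End Fibers.

(** * Relocating a finite set into disjoint cells *)

Section Compress.
Variables (T U V : choiceType) (p : T -> U) (s : U -> nat -> V) (M : nat).
Implicit Types A B : {fset T}.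

(** [s u 0], [s u 1], ... enumerates the cell of [u].  Each cell is filled in
    the order of this enumeration, whichever elements arrive there; this is
    what makes the operation monotone. *)
Definition compress A : {fset V} :=
  [fset s u.1 u.2 | u in stack (p @` A) (fiber_card p A)].

Lemma compressS A B : A `<=` B -> compress A `<=` compress B.
Proof.
move=> AB; apply/subset_imfset/fsubsetP/stackS => [|y _].
  exact/subset_imfset/fsubsetP.
exact: fiber_cardS.
Qed.

(** The bound on [A] keeps the indices within the range where the cells are
    under control. *)
Lemma mem_compress A v : #|` A| <= M -> v \in compress A ->
  exists2 a, a \in A & exists2 i, i < M & v = s (p a) i.
Proof.
move=> AM /imfsetP[[u i] /=]; rewrite in_stack => /andP[].
move=> /imfsetP[a /= aA ->] ilt ->; exists a => //; exists i => //.
by rewrite (leq_trans ilt) // (leq_trans (fiber_card_le p A _)).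
Qed.

Lemma card_compress A :
    (forall a b i j, i < M -> j < M ->
       s (p a) i = s (p b) j -> p a = p b /\ i = j) ->
  #|` A| <= M -> #|` compress A| = #|` A|.
Proof.
move=> s_inj AM; rewrite card_in_imfset /= ?card_stack ?sum_fiber_card //.
have fiberM u : fiber_card p A u <= M := leq_trans (fiber_card_le p A u) AM.
move=> [u i] [v j] /=; rewrite !in_stack.
move=> /andP[/imfsetP[a /= _ ->] iM] /andP[/imfsetP[b /= _ ->] jM].
by move=> /s_inj[||-> -> //]; [apply: leq_trans iM _|apply: leq_trans jM _].
Qed.

End Compress.

(** * Rounding to bounded cardinality *)

Section Normalize.
Variables (T U : choiceType) (p : T -> U) (M : nat).
Implicit Types A B : {fset T}.

(** The push-forward along [p] of the uniform probability measure on [A],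
    multiplied by [M] and rounded down. *)
Definition normalize A : {fset U * nat} :=
  stack (p @` A) (fun u => M * fiber_card p A u %/ #|` A|).

Lemma card_normalize_le A : #|` normalize A| <= M.
Proof.
rewrite card_stack; have [/cardfs0_eq->|A_gt0] := posnP #|` A|.
  by rewrite imfset0 big_seq_fset0.
rewrite -(leq_pmul2r A_gt0) big_distrl /=.
rewrite -[X in _ <= _ * X](sum_fiber_card p A) big_distrr /=.
by apply: leq_sum => u _; exact: leq_trunc_div.
Qed.

(** Without rounding, the intersection would have at least
    [M * |A & B| / max |A| |B|] elements, because the minimum of two densities
    is at least the common count over the larger total.  Rounding costs less
    than one element for each point of the image of [A & B]. *)
Lemma card_normalizeI A B :
  M * #|` A `&` B| <=
  (#|` normalize A `&` normalize B| + #|` p @` (A `&` B)|) *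
    maxn #|` A| #|` B|.
Proof.
set m := maxn _ _; set C := A `&` B.
pose f u := M * fiber_card p C u %/ m.
have sub D : C `<=` D -> #|` D| <= m -> stack (p @` C) f `<=` normalize D.
  move=> CD Dm; apply: stackS => [|u /imfsetP[a /= aC _]].
    exact/subset_imfset/fsubsetP.
  have D_gt0 : 0 < #|` D|.
    by rewrite cardfs_gt0; apply/fset0Pn; exists a; exact: (fsubsetP CD).
  apply: leq_trans (leq_div2l _ D_gt0 Dm).
  by apply: leq_div2r; rewrite leq_mul2l fiber_cardS ?orbT.
have stackI : #|` stack (p @` C) f| <= #|` normalize A `&` normalize B|.
  apply/fsubset_leq_card/fsubsetIP; split; apply: sub.
  - exact: fsubsetIl.
  - exact: leq_maxl.
  - exact: fsubsetIr.
  - exact: leq_maxr.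
have [m0|m_gt0] := posnP m.
  have := fsubset_leq_card (fsubsetIl A B).
  by rewrite -/C; have := leq_maxl #|` A| #|` B|; rewrite -/m m0; lia.
apply: leq_trans (leq_mul (leq_add stackI (leqnn _)) (leqnn m)).
rewrite -(sum_fiber_card p C) card_stack card_fset_sum1 -big_split /=.
rewrite big_distrr big_distrl /=; apply: leq_sum => u _.
by rewrite addn1 ltnW // ltn_ceil.
Qed.

(** Put [c = 1 + eps / 4].  The hypothesis bounds [max |A| |B|] by
    [c * |A & B|], so by [card_normalizeI] the new intersection [J] satisfies
    [M <= c * (J + K)].  The conclusion follows from [2 * M < (2 + eps) * J];
    multiplying by [c] and using [2 + eps = 2 * c + eps / 2], this is what the
    condition on [M] provides. *)
Lemma almost_equal_normalize (R : realType) (eps : R) (K : nat) A B :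
    (0 < eps)%R ->
    #|` p @` (A `&` B)| <= K ->
    ((2 + eps) * (1 + eps / 4) * K%:R < eps / 2 * M%:R)%R ->
  almost_equal (eps / 4)%R A B -> almost_equal eps (normalize A) (normalize B).
Proof.
move=> eps_gt0 YK MK /almost_equalE; rewrite natrD => AB.
apply/almost_equalE.
have cIA : (#|` A `&` B|%:R <= #|` A|%:R :> R)%R.
  by rewrite ler_nat fsubset_leq_card // fsubsetIl.
have cIB : (#|` A `&` B|%:R <= #|` B|%:R :> R)%R.
  by rewrite ler_nat fsubset_leq_card // fsubsetIr.
have I_ge0 : (0 <= #|` A `&` B|%:R :> R)%R by [].
have I_gt0 : (0 < #|` A `&` B|%:R :> R)%R by nra.
have max_le :
    ((maxn #|` A| #|` B|)%:R <= (1 + eps / 4) * #|` A `&` B|%:R :> R)%R.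
  by case: leqP => _; nra.
have cards : ((#|` normalize A| + #|` normalize B|)%:R <= 2 * M%:R :> R)%R.
  by rewrite -natrM ler_nat mul2n -addnn leq_add // card_normalize_le.
apply: (le_lt_trans cards).
set J := (#|` normalize A `&` normalize B|%:R)%R.
have J_ge0 : (0 <= J)%R by exact: ler0n.
have MJ : (M%:R <= (1 + eps / 4) * (J + K%:R))%R.
  rewrite -(ler_pM2r I_gt0) -natrM.
  apply: (@le_trans _ _ ((J + K%:R) * (maxn #|` A| #|` B|)%:R)%R).
    rewrite -natrD -natrM ler_nat; apply: (leq_trans (card_normalizeI A B)).
    by rewrite leq_mul2r leq_add2l YK orbT.
  rewrite mulrAC [X in (_ <= X)%R]mulrC; apply: ler_wpM2l => //.
  by rewrite addr_ge0.
have K_ge0 : (0 <= K%:R :> R)%R by exact: ler0n.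
have : ((2 + eps) * M%:R <= (2 + eps) * ((1 + eps / 4) * (J + K%:R)))%R.
  by rewrite ler_wpM2l //; lra.
move=> ?; have c_gt0 : (0 < 1 + eps / 4)%R by lra.
rewrite -(ltr_pM2l c_gt0); lra.
Qed.

End Normalize.

(** * Property A with uniformly bounded sets *)

Section Metric.
Variables (R : realType) (X : metricType R).
Local Open Scope ring_scope.

Lemma bounded_geometry_fset (S : R) : bounded_geometry X -> 0 < S ->
  exists K : nat, forall (x : X) (B : {fset X}),
    (forall y, y \in B -> mdist x y <= S) -> (#|` B| <= K)%N.
Proof.
move=> bg /bg[K ballK]; exists K => x B Bx.
rewrite -(set_fsetK B); apply: geq_card_fset_set.
apply: card_le_trans (ballK x); apply: subset_card_le => y /= /Bx.
by rewrite /cball /= metric_sym.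
Qed.

(** The sets of property A have uniformly bounded diameter, but above a point
    they may contain arbitrarily many labels, even on a single component;
    normalizing them makes their cardinals uniformly bounded. *)
Lemma property_A_bounded (r eps : R) :
    bounded_geometry X -> property_A X -> 0 < r -> 0 < eps ->
  exists M : nat, exists A : X -> {fset (X * nat)%type},
    [/\ forall x, (#|` A x| <= M)%N,
        forall x y, mdist x y <= r -> almost_equal eps (A x) (A y)
      & exists2 S : R, 0 < S &
          forall x a, a \in A x -> mdist x a.1 <= S].
Proof.
move=> bg pA r_gt0 eps_gt0.
have eps4_gt0 : 0 < eps / 4 by lra.
have [A [_ A_close [S S_gt0 A_near]]] := pA r (eps / 4) r_gt0 eps4_gt0.
have [K ballK] := bounded_geometry_fset bg S_gt0.
pose M := Num.bound ((2 + eps) * (1 + eps / 4) * K%:R / (eps / 2)).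
exists M, (fun x => normalize fst M (A x)); split=> [x|x y xy|].
- exact: card_normalize_le.
- apply: (@almost_equal_normalize _ _ _ _ _ _ K) => //; last exact: A_close.
    apply: (ballK x) => _ /imfsetP[[y' n] /= + ->].
    by rewrite inE => /andP[/A_near].
  rewrite [X in _ < X]mulrC -ltr_pdivrMr; last lra.
  apply: archi_boundP.
  by rewrite !mulr_ge0 ?invr_ge0 ?addr_ge0 //; lra.
- exists S => // x [y i]; rewrite in_stack => /andP[].
  by move=> /imfsetP[[y' n] /= /A_near xy' ->].
Qed.

(** * Large disjoint cells *)

Lemma rips_path_dist (r : {nonneg R}) (d x : X) (p : seq X) (i : nat) :
    path (fun a b => `[< simplex (rips_complex X r) [fset a; b] >]) x p ->
  (i <= size p)%N -> mdist x (nth d (x :: p) i) <= r%:num *+ i.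
Proof.
elim: p x i => [|y p IHp] x [|i] //=; rewrite ?mdistxx //.
move=> /andP[/asboolP[_ xy] /IHp py] ip.
rewrite mulrS (le_trans (metric_triangle _ y _)) // lerD ?py //.
by apply: xy; rewrite !inE eqxx ?orbT.
Qed.

(** A path from [x] to a vertex at distance more than [r * M], once its loops
    are removed, has at least [M] edges; the first [M] of its vertices are
    distinct and close to [x]. *)
Lemma unbounded_component_points (r : {nonneg R}) (x : X) (M : nat) :
    unbounded (component (rips_complex X r) x) ->
  exists t : seq X, [/\ uniq t, size t = M
    & forall y, y \in t -> mdist x y <= r%:num *+ M].
Proof.
move=> unb.
have [w [p path_p <-] far] : exists2 w,
    component (rips_complex X r) x w & r%:num *+ M < mdist x w.
  apply: contrapT => near; apply: unb; exists (r%:num *+ M + r%:num *+ M).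
  have {}near w : component (rips_complex X r) x w -> mdist x w <= r%:num *+ M.
    by move=> xw; rewrite leNgt; apply/negP => far; apply: near; exists w.
  move=> y z /near xy /near xz; rewrite (le_trans (metric_triangle _ x _)) //.
  by rewrite metric_sym lerD.
case/shortenP: path_p far => q path_q uniq_q _ far.
have Mq : (M <= size q)%N.
  rewrite leqNgt; apply/negP => qM; move: far; rewrite ltNge => /negP; apply.
  rewrite (last_nth x) (le_trans (rips_path_dist x path_q (leqnn _))) //.
  by rewrite ler_wpMn2l // ltnW.
exists (take M (x :: q)); split=> [||y].
- exact: take_uniq.
- by rewrite size_takel //= ltnW.
- move=> /(nthP x)[i]; rewrite size_takel; last by rewrite ltnW.
  move=> iM <-; rewrite nth_take //.
  rewrite (le_trans (rips_path_dist x path_q _)) //.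
    by rewrite (leq_trans (ltnW iM)).
  by rewrite ler_wpMn2l // ltnW.
Qed.

(** By Zorn: a point at distance more than [L] from all of a maximal separated
    set could be added to it. *)
Lemma maximal_separated (L : R) : 0 <= L ->
  exists Y : set X,
    (forall x y, Y x -> Y y -> mdist x y <= L -> x = y) /\
    forall x, exists2 y, Y y & mdist x y <= L.
Proof.
move=> L_ge0.
pose sep (Y : set X) := forall x y, Y x -> Y y -> mdist x y <= L -> x = y.
have [|Y [sepY maxY]] := @Zorn_bigcup X sep.
  move=> F Fsep Ftot x y [A FA Ax] [B FB By].
  by have [AB|BA] := Ftot A B FA FB; [apply: (Fsep B)|apply: (Fsep A)] => //;
    [exact: AB|exact: BA].
exists Y; split=> // x; apply: contrapT => far.
have {}far y : Y y -> ~ mdist x y <= L by move=> Yy xy; apply: far; exists y.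
apply: (maxY (Y `|` [set x])%classic).
  split=> [|sub]; first by left.
  by apply: (far x); [apply: sub; right|rewrite mdistxx].
move=> y z [Yy|->] [Yz|->] //.
- exact: sepY.
- by rewrite metric_sym => /far; case.
- by move=> /far; case.
Qed.

(** Here [s y] lists [M] distinct points at distance at most [r * M] from [y],
    and [p] takes values in a [2 r M]-separated set; a point common to the
    cells of [p x] and [p y] would put these at distance at most [2 r M]. *)
Lemma disjoint_cells (M : nat) : coarsely_unbounded_components X ->
  exists (p : X -> X) (s : X -> nat -> X) (D : R),
    [/\ 0 <= D,
        forall x i, (i < M)%N -> mdist x (s (p x) i) <= D
      & forall x y i j, (i < M)%N -> (j < M)%N ->
          s (p x) i = s (p y) j -> p x = p y /\ i = j].
Proof.
move=> [r unb]; pose L := r%:num *+ M + r%:num *+ M.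
have rM_ge0 : 0 <= r%:num *+ M by exact: mulrn_wge0.
have [Y [sepY coverY]] := maximal_separated (addr_ge0 rM_ge0 rM_ge0).
have [p pY] := choice (fun x => let: ex_intro2 y Yy xy := coverY x in
  ex_intro (fun y => Y y /\ mdist x y <= L) y (conj Yy xy)).
have [t tP] := choice (fun x => unbounded_component_points M (unb x)).
have near y i : (i < M)%N -> mdist y (nth y (t y) i) <= r%:num *+ M.
  by have [_ sz near] := tP y => iM; apply: near; rewrite mem_nth ?sz.
exists p, (fun y i => nth y (t y) i), (L + r%:num *+ M); split=> [|x i iM|].
- by rewrite !addr_ge0.
- by rewrite (le_trans (metric_triangle _ (p x) _)) // lerD ?near ?(pY x).2.
- move=> x y i j iM jM eq_s.
  have pxy : p x = p y.
    apply: sepY; [exact: (pY x).1|exact: (pY y).1|].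
    rewrite (le_trans (metric_triangle _ (nth (p x) (t (p x)) i) _)) //.
    by rewrite lerD ?near // eq_s metric_sym near.
  split=> //; move: eq_s; rewrite pxy => /eqP.
  by have [t_uniq sz _] := tP (p y); rewrite nth_uniq ?sz // => /eqP.
Qed.

(** * The equivalence *)

Lemma naive_property_A_property_A : naive_property_A X -> property_A X.
Proof.
move=> nA r eps r_gt0 eps_gt0.
have [A [A_neq0 A_close [S S_gt0 A_near]]] := nA r eps r_gt0 eps_gt0.
exists (fun x => [fset (y, 0%N) | y in A x]); split=> [x|x y xy|].
- have /fset0Pn[y yA] := A_neq0 x.
  by apply/fset0Pn; exists (y, 0%N); apply/imfsetP; exists y.
- apply: (@almost_equal_monotone_isocard _ _ _ _
    (fun C : {fset X} => [fset (z, 0%N) | z in C])) (A_close x y xy) => //.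
    by move=> C D /fsubsetP CD; exact: subset_imfset.
  by move=> C _; rewrite card_imfset // => a b [].
- by exists S => // x y n /imfsetP[z /= zA [-> _]]; exact: A_near.
Qed.

Lemma property_A_naive_property_A :
    bounded_geometry X -> coarsely_unbounded_components X ->
  property_A X -> naive_property_A X.
Proof.
move=> bg unb pA r eps r_gt0 eps_gt0.
have [M [A [A_le A_close [S S_gt0 A_near]]]] :=
  property_A_bounded bg pA r_gt0 eps_gt0.
have [p [s [D [D_ge0 s_near s_inj]]]] := disjoint_cells M unb.
pose F : {fset X * nat} -> {fset X} := compress (p \o fst) s.
have F_close x y : mdist x y <= r -> almost_equal eps (F (A x)) (F (A y)).
  move=> /A_close; apply: almost_equal_monotone_isocard => // [C E|C CA].
    exact: compressS.
  apply: (@card_compress _ _ _ _ _ M) => [a b i j|].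
    exact: s_inj.
  by case: CA => /fsubset_leq_card/leq_trans; apply.
exists (fun x => F (A x)); split=> [x||].
- (* a set that is almost equal to itself is not empty *)
  have [|+ _] := F_close x x; first by rewrite mdistxx ltW.
  by rewrite fsetIid.
- exact: F_close.
- exists (S + D) => [|x y]; first by rewrite ltr_wpDr.
  move=> /(mem_compress (A_le x))[a aA [i iM ->]].
  by rewrite (le_trans (metric_triangle _ a.1 _)) // lerD ?A_near ?s_near.
Qed.

End Metric.

Theorem theoremA (R : realType) (X : metricType R)
    (X_discrete : discrete_space X)
    (X_bounded_geometry : bounded_geometry X)
    (X_unbounded_components : coarsely_unbounded_components X) :
  property_A X <-> naive_property_A X.
Proof.
split; first exact: property_A_naive_property_A.
exact: naive_property_A_property_A.
Qed.
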